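(* If $1$ is not an eigenvalue of the linear operator $\mathcal{K}$, then for each $l=1,2,\dots,L$ the approximate solution $y_l^*$ and the optimal error $e_l^*$ of the continuous multi-grade deep learning model satisfy $$\|\mathcal{I}-\mathcal{K}\|^{-1}\|e_l^*\|_2\le\|y-y_l^*\|_2\le\|(\mathcal{I}-\mathcal{K})^{-1}\|\,\|e_l^*\|_2 .$$
   Context: Let $I:=[-1,1]$, let $C(I)$ be the space of continuous complex-valued functions on $I$, and $\|g\|_2:=(\int_I|g(s)|^2ds)^{1/2}$. Let $\kappa\ge 1$, let $K$ be a continuous complex-valued function on $I^2$, and $f\in C(I)$. Define $(\mathcal{K}h)(s):=\int_I K(s,t)e^{i\kappa|s-t|}h(t)\,dt$ for $h\in C(I)$, $s\in I$; $\mathcal{I}$ is the identity operator on $C(I)$. The function $y\in C(I)$ is the solution of $(\mathcal{I}-\mathcal{K})y=f$. Operator norms are those induced by $\|\cdot\|_2$. For a function $u=[u_1,u_2]^T$ with $u_1,u_2$ real-valued on $I$, $\mathcal{T}u:=u_1+iu_2$. Let $\sigma:\mathbb{R}\to\mathbb{R}$ be a continuous activation function, applied componentwise to vectors. For weight matrices $\mathbf{W}_j$ and bias vectors $\mathbf{b}_j$ of compatible sizes and an input vector $x$, let $\mathcal{F}_k(\{\mathbf{W}_j,\mathbf{b}_j\}_{j=1}^k;x)$ be the result of applying to $x$ successively the maps $v\mapsto\sigma(\mathbf{W}_jv+\mathbf{b}_j)$, $j=1,\dots,k$ (the identity if $k=0$), and let $\mathcal{N}_n(\{\mathbf{W}_j,\mathbf{b}_j\}_{j=1}^n;x):=\mathbf{W}_n\mathcal{F}_{n-1}(\{\mathbf{W}_j,\mathbf{b}_j\}_{j=1}^{n-1};x)+\mathbf{b}_n$.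 Continuous multi-grade deep learning model: let $L$ and $n_1,\dots,n_L$ be positive integers, and let $m_{l,j}$ ($1\le l\le L$, $0\le j\le n_l$) be positive integers with $m_{1,0}=1$, $m_{l,n_l}=2$, and $m_{l+1,0}=m_{l,n_l-1}$. Put $\mathbf{g}_0(s):=s$ and $y_0^*:=0$. Recursively for $l=1,\dots,L$: for $\theta=\{\mathbf{W}_j,\mathbf{b}_j\}_{j=1}^{n_l}$ with $\mathbf{W}_j\in\mathbb{R}^{m_{l,j}\times m_{l,j-1}}$, $\mathbf{b}_j\in\mathbb{R}^{m_{l,j}}$, set $$e_l(\theta;s):=\big(f-(\mathcal{I}-\mathcal{K})(y_{l-1}^*+\mathcal{T}\mathcal{N}_{n_l}(\theta;\mathbf{g}_{l-1}(\cdot)))\big)(s),\quad s\in I;$$ let $\{\mathbf{W}_{l,j}^*,\mathbf{b}_{l,j}^*\}_{j=1}^{n_l}$ be a minimizer of $\|e_l(\theta;\cdot)\|_2^2$ over all such $\theta$ (existence of minimizers is assumed throughout); set $\mathbf{g}_l(s):=\mathcal{F}_{n_l-1}(\{\mathbf{W}_{l,j}^*,\mathbf{b}_{l,j}^*\}_{j=1}^{n_l-1};\mathbf{g}_{l-1}(s))$, $\mathbf{f}_l(s):=\mathbf{W}_{l,n_l}^*\mathbf{g}_l(s)+\mathbf{b}_{l,n_l}^*$, $y_l^*:=\sum_{j=1}^l\mathcal{T}\mathbf{f}_j$, and $e_l^*(s):=e_l(\{\mathbf{W}_{l,j}^*,\mathbf{b}_{l,j}^*\}_{j=1}^{n_l};s)$.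 *)

(* Defs.v *)
From mathcomp Require Import all_boot all_order all_algebra.
From mathcomp Require Import complex.
From mathcomp Require Import all_classical all_reals all_analysis.

Set Implicit Arguments.
Unset Strict Implicit.
Unset Printing Implicit Defensive.

Import Order.TTheory GRing.Theory Num.Theory.
Import numFieldNormedType.Exports.

Local Open Scope classical_set_scope.
Local Open Scope complex_scope.
Local Open Scope ring_scope.

Definition II (R : realType) : set R := `[(-1 : R), 1]%classic.
Arguments II : clear implicits.

(* Elements of C(I) are total functions R -> R[i], continuous on I for the
   subspace topology; values outside I are irrelevant, so two of them represent
   the same element of C(I) when they satisfy eqI.
   The norm topology on R[i] is available through its alias R[i]^o. *)
Definition CI (R : realType) (g : R -> R[i]) : Prop :=
  {within II R, continuous (g : R -> R[i]^o)}.

Definition eqI (R : realType) (g h : R -> R[i]) : Prop := forall s, II R s -> g s = h s.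

Definition cintI (R : realType) (g : R -> R[i]) : R[i] :=
  (\int[lebesgue_measure]_(t in II R) complex.Re (g t)) +i*
  (\int[lebesgue_measure]_(t in II R) complex.Im (g t)).

Definition norm2 (R : realType) (g : R -> R[i]) : R :=
  Num.sqrt (\int[lebesgue_measure]_(s in II R) (Normc.normc (g s) ^+ 2)).

Definition cis (R : realType) (x : R) : R[i] := cos x +i* sin x.

Definition Kop (R : realType) (kappa : R) (K : R * R -> R[i]) (h : R -> R[i]) : R -> R[i] :=
  fun s => cintI (fun t => K (s, t) * cis (kappa * `|s - t|) * h t).

Definition IKop (R : realType) (kappa : R) (K : R * R -> R[i]) (h : R -> R[i]) : R -> R[i] :=
  fun s => h s - Kop kappa K h s.

Definition is_eigenvalue (R : realType) (A : (R -> R[i]) -> (R -> R[i])) (lambda : R[i]) : Prop :=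
  exists h, [/\ CI h, ~ eqI h (fun=> 0) & eqI (A h) (fun s => lambda * h s)].

Definition bounded_op (R : realType) (A : (R -> R[i]) -> (R -> R[i])) : Prop :=
  exists M : R, forall h, CI h -> norm2 (A h) <= M * norm2 h.

(* Meaningful for bounded_op operators only: sup is 0 on unbounded sets. *)
Definition opnorm (R : realType) (A : (R -> R[i]) -> (R -> R[i])) : R :=
  sup [set norm2 (A h) | h in [set h | CI h /\ norm2 h <= 1]].

(* B is the two-sided inverse of A on C(I); it is unique up to eqI. *)
Definition is_inverse_op (R : realType) (A B : (R -> R[i]) -> (R -> R[i])) : Prop :=
  [/\ forall h, CI h -> CI (A h),
      forall h, CI h -> CI (B h),
      forall h, CI h -> eqI (A (B h)) h &
      forall h, CI h -> eqI (B (A h)) h].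

(* Weights and biases of a network with layer widths m 0, m 1, ...: layer j
   maps R^(m j.-1) to R^(m j), and layers are numbered from 1.  A network with
   n layers only uses the entries 1 <= j <= n. *)
Record params (R : realType) (m : nat -> nat) := Params {
  weight : forall j : nat, 'M[R]_(m j, m j.-1);
  bias : forall j : nat, 'cV[R]_(m j) }.

Fixpoint hidden (R : realType) (sigma : R -> R) (m : nat -> nat) (theta : params R m)
    (k : nat) (x : 'cV[R]_(m 0)) : 'cV[R]_(m k) :=
  match k return 'cV[R]_(m k) with
  | 0 => x
  | k'.+1 => map_mx sigma (weight theta k'.+1 *m hidden sigma theta k' x + bias theta k'.+1)
  end.

Definition network (R : realType) (sigma : R -> R) (m : nat -> nat) (theta : params R m)
    (n : nat) (x : 'cV[R]_(m 0)) : 'cV[R]_(m n) :=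
  weight theta n *m hidden sigma theta n.-1 x + bias theta n.

Definition toC (R : realType) (u : 'cV[R]_2) : R[i] := u ord0 ord0 +i* u ord_max ord0.

(* In the model, grade l has n l layers of widths m l 0, ..., m l (n l), and
   grades are numbered from 1.  Widths agreeing only by a propositional equality
   (m 1 0 = 1, m l (n l) = 2, m l.+1 0 = m l (n l).-1) are identified by
   conform_mx 0, which is the identity cast under these equalities. *)

Definition feat_dim (n : nat -> nat) (m : nat -> nat -> nat) (l : nat) : nat :=
  match l with 0 => 1%N | l'.+1 => m l'.+1 (n l'.+1).-1 end.

Section Model.
Variables (R : realType) (kappa : R) (K : R * R -> R[i]) (f : R -> R[i]).
Variables (sigma : R -> R) (n : nat -> nat) (m : nat -> nat -> nat).
Variable thetas : forall l : nat, params R (m l).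

Fixpoint feat (l : nat) (s : R) : 'cV[R]_(feat_dim n m l) :=
  match l return 'cV[R]_(feat_dim n m l) with
  | 0 => const_mx s
  | l'.+1 => hidden sigma (thetas l'.+1) (n l'.+1).-1 (conform_mx 0 (feat l' s))
  end.

Definition grade_net (l : nat) (theta : params R (m l)) : R -> R[i] :=
  fun s => toC (conform_mx 0 (network sigma theta (n l) (conform_mx 0 (feat l.-1 s)))).

(* T f_l is grade_net at the optimal parameters, because
   f_l = W*_(l,n_l) g_l + b*_(l,n_l) is the trained network of grade l. *)
Definition approx_sol (l : nat) : R -> R[i] :=
  fun s => \sum_(1 <= j < l.+1) grade_net (thetas j) s.

Definition grade_err (l : nat) (theta : params R (m l)) : R -> R[i] :=
  fun s => f s - IKop kappa K (fun t => approx_sol l.-1 t + grade_net theta t) s.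

Definition opt_err (l : nat) : R -> R[i] := grade_err (thetas l).

Definition grade_minimizer (l : nat) : Prop :=
  forall theta : params R (m l),
    norm2 (opt_err l) ^+ 2 <= norm2 (grade_err theta) ^+ 2.

End Model.

(* Main.v *)
Require Import Defs.
From mathcomp Require Import all_boot all_order all_algebra.
From mathcomp Require Import complex.
From mathcomp Require Import all_classical all_reals all_analysis.
From mathcomp Require Import ring lra.

Set Implicit Arguments.
Unset Strict Implicit.
Unset Printing Implicit Defensive.

Import Order.TTheory GRing.Theory Num.Theory.
Import numFieldNormedType.Exports.

Local Open Scope classical_set_scope.
Local Open Scope complex_scope.
Local Open Scope ring_scope.

(** Let [A = I - K].  On the interval, [f = A y] and the optimal error of grade
    [l] is [f - A y_l], so it equals [A (y - y_l)] by linearity.  If [A] is bounded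
    and has a bounded inverse [B] on [C(I)], the two inequalities are
    [norm2 (A d) <= opnorm A * norm2 d] and [norm2 (B e) <= opnorm B * norm2 e] for
    [d = y - y_l] and [e = A d] ([residual_bounds], [opt_err_residual]); [d] is
    continuous because networks are ([CI_approx_sol]).

    The substance is the invertibility of [A], that is the Fredholm alternative for
    a continuous kernel [k] ([fredholm_alternative]), proved by degenerate
    approximation.  By uniform continuity, [k] is the sum of a kernel [k0] bounded
    by 1/8 and of a finite sum of products [phi_i(s) k(p_i, t)], where the
    [phi_i] form a partition of unity ([degenerate_split]).  The operator
    [I - K0] is solved by a Neumann series ([neumann_solution]), which turns
    [u - K u = f] into a square linear system for the numbers [(K u)(p_i)].  If 1
    is not an eigenvalue of [K] then the matrix of this system has trivial kernel,
    so it is invertible.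

    Boundedness in the 2-norm is read off pointwise.  Integral operators with
    bounded kernel map the L1 norm to the uniform norm, so both [A] and its inverse
    satisfy [|T h| <= |h| + D * normL1 h] at every point of the interval, and the
    L1 norm is at most a constant times the 2-norm. *)

(** * Complex-valued continuous functions *)

Section Continuity.
Variable R : realType.
Implicit Types (z : R[i]).

Lemma normc_ge0 z : 0 <= Normc.normc z.
Proof. by case: z => a b; exact: sqrtr_ge0. Qed.

Lemma normc_ge_absRe z : `|complex.Re z| <= Normc.normc z.
Proof.
case: z => a b /=; rewrite -[X in X <= _]ger0_norm// -sqrtr_sqr.
rewrite ler_sqrt ?sqr_ge0 ?addr_ge0 ?sqr_ge0// real_normK ?num_real//.
by rewrite lerDl sqr_ge0.
Qed.

Lemma normc_ge_absIm z : `|complex.Im z| <= Normc.normc z.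
Proof.
case: z => a b /=; rewrite -[X in X <= _]ger0_norm// -sqrtr_sqr.
rewrite ler_sqrt ?sqr_ge0 ?addr_ge0 ?sqr_ge0// real_normK ?num_real//.
by rewrite lerDr sqr_ge0.
Qed.

Lemma normc_le_absReIm z :
  Normc.normc z <= `|complex.Re z| + `|complex.Im z|.
Proof.
case: z => a b /=; rewrite -[X in _ <= X]ger0_norm ?addr_ge0// -sqrtr_sqr.
rewrite ler_sqrt ?sqr_ge0// sqrrD !real_normK ?num_real//.
by rewrite addrAC lerDl mulrn_wge0 ?mulr_ge0.
Qed.

Lemma normcD (x z : R[i]) :
  Normc.normc (x + z) <= Normc.normc x + Normc.normc z.
Proof. exact: le_normcD. Qed.

Lemma normc_opp z : Normc.normc (- z) = Normc.normc z.
Proof. exact: normcN. Qed.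

Lemma normc_distC (x z : R[i]) : Normc.normc (x - z) = Normc.normc (z - x).
Proof. by rewrite -normc_opp opprB. Qed.

Lemma normc_real (a : R) : Normc.normc a%:C = `|a|.
Proof. by rewrite /= expr0n /= addr0 sqrtr_sqr. Qed.

Lemma normc_sum (I : Type) (r : seq I) (P : pred I) (F : I -> R[i]) :
  Normc.normc (\sum_(i <- r | P i) F i)
  <= \sum_(i <- r | P i) Normc.normc (F i).
Proof.
elim/big_rec2 : _ => [|i a b _ ab]; first by rewrite Normc.normc0.
by apply: (le_trans (normcD _ _)); rewrite lerD2l.
Qed.

(** The radii of balls in [R[i]^o] are complex numbers; a positive one is real,
    so convergence can be tested with real radii and the real modulus. *)
Lemma cvg_normcP (T : Type) (F : set_system T) (FF : Filter F)
    (g : T -> R[i]) (l : R[i]) :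
  ((g x : R[i]^o) @[x --> F] --> (l : R[i]^o)) <->
  (forall e : R, 0 < e -> \forall x \near F, Normc.normc (l - g x) < e).
Proof.
split.
  move=> /(@cvgrPdist_lt R[i] R[i]^o) gl e e0.
  have := gl (e%:C); rewrite ltcR => /(_ e0); apply: filterS => x.
  by rewrite -ltcR.
move=> gl; apply/(@cvgrPdist_lt R[i] R[i]^o) => -[e e'].
rewrite ltcE /= => /andP[/eqP -> e0].
by apply: filterS (gl _ e0) => x; rewrite -ltcR.
Qed.

Lemma within_normcP (T : topologicalType) (A : set T) (g : T -> R[i]) :
  {within A, continuous (g : T -> R[i]^o)} <->
  (forall x, A x -> forall e : R, 0 < e ->
     \forall y \near within A (nbhs x), Normc.normc (g x - g y) < e).
Proof.
split.
  move=> /subspace_continuousP gc x Ax; apply/cvg_normcP; exact: gc.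
by move=> h; apply/subspace_continuousP => x Ax; apply/cvg_normcP; exact: h.
Qed.

(** Reduces the continuity of complex functions to the theory of real ones. *)
Lemma within_ReImP (T : topologicalType) (A : set T) (g : T -> R[i]) :
  {within A, continuous (g : T -> R[i]^o)} <->
  {within A, continuous (fun x => complex.Re (g x))} /\
  {within A, continuous (fun x => complex.Im (g x))}.
Proof.
split=> [/within_normcP gc|[/subspace_continuousP rc /subspace_continuousP ic]].
  split; apply/subspace_continuousP => x Ax; apply/cvgrPdist_lt => e e0;
    apply: filterS (gc x Ax e e0) => z; apply: le_lt_trans.
    by rewrite -raddfB; exact: normc_ge_absRe.
  by rewrite -raddfB; exact: normc_ge_absIm.
apply/within_normcP => x Ax e e0.
have e20 : 0 < e / 2 by rewrite divr_gt0.
have /cvgrPdist_lt/(_ _ e20) h1 := rc x Ax.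
have /cvgrPdist_lt/(_ _ e20) h2 := ic x Ax.
apply: filterS2 h1 h2 => z h1 h2.
apply: (le_lt_trans (normc_le_absReIm _)).
by rewrite (splitr e) !raddfB ltrD.
Qed.

Lemma CI_epsP (g : R -> R[i]) :
  CI g <-> forall s, II R s -> forall e : R, 0 < e -> exists2 d : R, 0 < d &
    forall t, II R t -> `|s - t| < d -> Normc.normc (g s - g t) < e.
Proof.
split=> [/within_normcP gc s Is e e0|gc].
  have [d /= d0 dP] := gc s Is e e0.
  by exists d => // t It st; exact: dP.
apply/within_normcP => s Is e e0; have [d d0 dP] := gc s Is e e0.
by exists d => //= t st It; exact: dP.
Qed.

Section ContinuousAlgebra.
Variables (T : topologicalType) (A : set T).

Lemma within_cstC (c : R[i]) : {within A, continuous (fun _ : T => c : R[i]^o)}.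
Proof. by apply: continuous_subspaceT => x; exact: cvg_cst. Qed.

Lemma within_addC (g h : T -> R[i]) :
  {within A, continuous (g : T -> R[i]^o)} ->
  {within A, continuous (h : T -> R[i]^o)} ->
  {within A, continuous (fun x => g x + h x : R[i]^o)}.
Proof. exact: (@within_continuousD T R[i] R[i]^o). Qed.

Lemma within_mul (F : numFieldType) (g h : T -> F) :
  {within A, continuous (g : T -> F^o)} ->
  {within A, continuous (h : T -> F^o)} ->
  {within A, continuous (fun x => g x * h x : F^o)}.
Proof.
move=> /subspace_continuousP gc /subspace_continuousP hc.
by apply/subspace_continuousP => x Ax; apply: cvgM; [exact: gc|exact: hc].
Qed.

Lemma within_sum (I : Type) (r : seq I) (g : I -> T -> R[i]) :
  (forall i, {within A, continuous (g i : T -> R[i]^o)}) ->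
  {within A, continuous (fun x => \sum_(i <- r) g i x : R[i]^o)}.
Proof.
move=> gc; elim: r => [|i r IH].
  under eq_fun do rewrite big_nil; exact: within_cstC.
under eq_fun do rewrite big_cons.
exact: (within_addC (gc i) IH).
Qed.

End ContinuousAlgebra.

Lemma CI_normc (g : R -> R[i]) : CI g ->
  {within II R, continuous (fun s => Normc.normc (g s))}.
Proof.
move=> /within_normcP gc; apply/subspace_continuousP => x Ax.
apply/cvgrPdist_lt => e e0; apply: filterS (gc x Ax e e0) => z.
apply: le_lt_trans.
have tri (a b : R[i]) : Normc.normc a - Normc.normc b <= Normc.normc (a - b).
  by rewrite lerBlDr; apply: le_trans (normcD _ _); rewrite subrK.
by rewrite ler_norml tri andbT lerNl opprB normc_distC tri.
Qed.

Lemma CI_bounded (g : R -> R[i]) : CI g ->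
  exists2 M : R, 0 <= M & forall s, II R s -> Normc.normc (g s) <= M.
Proof.
move=> /CI_normc gc; have le11 : (-1 : R) <= 1 by lra.
have [c _ cP] := EVT_max le11 gc.
by exists (Normc.normc (g c)); [exact: normc_ge0|move=> s Is; exact: cP].
Qed.

End Continuity.

(** * Integration over the interval *)

Section Integral.
Variable R : realType.
Local Notation mu := (@lebesgue_measure R).
Local Notation "'\Int' f" := (\int[lebesgue_measure]_(t in II R) f t)
  (at level 10).
Implicit Types (f g : R -> R) (h : R -> R[i]).

Definition ctsI f := {within II R, continuous f}.

Lemma measurable_II : measurable (II R).
Proof. exact: measurable_itv. Qed.
Hint Resolve measurable_II : core.

Lemma ctsI_integrable f : ctsI f -> mu.-integrable (II R) (EFin \o f).
Proof.
by move=> fc; apply: continuous_compact_integrable fc; exact: segment_compact.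
Qed.

Lemma intID f g : ctsI f -> ctsI g ->
  \Int (fun t => f t + g t) = \Int f + \Int g.
Proof. by move=> fc gc; rewrite RintegralD//; exact: ctsI_integrable. Qed.

Lemma intIZ (a : R) f : ctsI f -> \Int (fun t => a * f t) = a * \Int f.
Proof. by move=> fc; rewrite RintegralZl//; exact: ctsI_integrable. Qed.

Lemma ctsI_cst (a : R) : ctsI (fun=> a).
Proof. by apply: continuous_subspaceT => x; exact: cvg_cst. Qed.

Lemma intI_cst (a : R) : \Int (fun=> a) = a * 2.
Proof.
rewrite Rintegral_cst//= lebesgue_measure_itv /= lte_fin.
by rewrite ifT; [congr (_ * _); rewrite /=; lra|lra].
Qed.

Lemma intI_le f g : ctsI f -> ctsI g -> (forall t, II R t -> f t <= g t) ->
  \Int f <= \Int g.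
Proof.
by move=> fc gc fg; apply: le_Rintegral => //; exact: ctsI_integrable.
Qed.

Lemma intI_ge0 f : (forall t, II R t -> 0 <= f t) -> 0 <= \Int f.
Proof. by move=> f0; apply: (@Rintegral_ge0 _ _ _ mu). Qed.

Lemma ctsID f g : ctsI f -> ctsI g -> ctsI (fun t => f t + g t).
Proof. exact: within_continuousD. Qed.

Lemma ctsIM f g : ctsI f -> ctsI g -> ctsI (fun t => f t * g t).
Proof. exact: within_mul. Qed.

Lemma ctsI_norm f : ctsI f -> ctsI (fun t => `|f t|).
Proof.
move=> /subspace_continuousP fc; apply/subspace_continuousP => x Ax.
by apply: cvg_norm; exact: fc.
Qed.

Lemma ctsI_normc2 h : CI h -> ctsI (fun t => Normc.normc (h t) ^+ 2).
Proof. by move=> hc; apply: ctsIM; exact: CI_normc. Qed.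

(** Cauchy-Schwarz against the constant 1, obtained by integrating
    [(f - c) ^+ 2 >= 0] with [c] the mean of [f] over an interval of length 2. *)
Lemma intI_sqr_le f : ctsI f -> (\Int f) ^+ 2 <= 2 * \Int (fun t => f t ^+ 2).
Proof.
move=> fc; set J := \Int f.
have : 0 <= \Int (fun t => (f t - J / 2) ^+ 2).
  by apply: intI_ge0 => t _; exact: sqr_ge0.
have -> : (fun t => (f t - J / 2) ^+ 2) =
          (fun t => f t * f t + ((- J) * f t + J ^+ 2 / 4)).
  by apply/funext => t; field.
rewrite intID; last 2 first.
- exact: ctsIM.
- by apply: ctsID; [apply: ctsIM => //|]; exact: ctsI_cst.
rewrite intID; last 2 first.
- by apply: ctsIM => //; exact: ctsI_cst.
- exact: ctsI_cst.
rewrite intIZ// intI_cst -/J.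
by under [X in _ -> _ <= _ * X]eq_Rintegral do rewrite expr2; nra.
Qed.

Lemma cintI_eq h1 h2 : eqI h1 h2 -> cintI h1 = cintI h2.
Proof.
move=> e; rewrite /cintI; congr (_ +i* _);
  by apply: eq_Rintegral => t /set_mem It; rewrite e.
Qed.

Lemma CI_Re h : CI h -> ctsI (fun t => complex.Re (h t)).
Proof. by move=> /within_ReImP[]. Qed.

Lemma CI_Im h : CI h -> ctsI (fun t => complex.Im (h t)).
Proof. by move=> /within_ReImP[]. Qed.

Lemma cintID h1 h2 : CI h1 -> CI h2 ->
  cintI (fun t => h1 t + h2 t) = cintI h1 + cintI h2.
Proof.
move=> c1 c2; rewrite /cintI.
have -> : (fun t => complex.Re (h1 t + h2 t)) =
          (fun t => complex.Re (h1 t) + complex.Re (h2 t)).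
  by apply/funext => t; rewrite raddfD.
have -> : (fun t => complex.Im (h1 t + h2 t)) =
          (fun t => complex.Im (h1 t) + complex.Im (h2 t)).
  by apply/funext => t; rewrite raddfD.
by rewrite !intID//; [exact: CI_Im|exact: CI_Im|exact: CI_Re|exact: CI_Re].
Qed.

Lemma cintIZ (c : R[i]) h : CI h -> cintI (fun t => c * h t) = c * cintI h.
Proof.
case: c => a b hc; rewrite /cintI.
have hr := CI_Re hc; have hi := CI_Im hc.
have -> : (fun t => complex.Re ((a +i* b) * h t)) =
          (fun t => a * complex.Re (h t) + (- b) * complex.Im (h t)).
  by apply/funext => t; case: (h t) => u v /=; rewrite mulNr.
have -> : (fun t => complex.Im ((a +i* b) * h t)) =
          (fun t => a * complex.Im (h t) + b * complex.Re (h t)).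
  by apply/funext => t; case: (h t) => u v.
rewrite !intID ?intIZ//; try (by apply: ctsIM => //; exact: ctsI_cst).
by rewrite mulNr.
Qed.

Lemma cintI0 : cintI (fun=> 0 : R[i]) = 0.
Proof. by rewrite /cintI /= intI_cst mul0r. Qed.

Lemma cintI_sum (I : Type) (r : seq I) (F : I -> R -> R[i]) :
  (forall i, CI (F i)) ->
  cintI (fun t => \sum_(i <- r) F i t) = \sum_(i <- r) cintI (F i).
Proof.
move=> Fc; elim: r => [|i r IH].
  by rewrite big_nil; under eq_fun do rewrite big_nil; exact: cintI0.
under eq_fun do rewrite big_cons.
by rewrite cintID ?big_cons ?IH//; exact: within_sum.
Qed.

(** The factor 2 comes from bounding the real and imaginary parts separately;
    it saves rotating the integral onto the real axis. *)
Lemma normc_cintI_le h : CI h ->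
  Normc.normc (cintI h) <= 2 * \Int (fun t => Normc.normc (h t)).
Proof.
move=> hc; have hn := CI_normc hc.
apply: (le_trans (normc_le_absReIm _)); rewrite /cintI /= mulr_natl mulr2n.
apply: lerD.
  apply: (le_trans (le_normr_Rintegral _ (ctsI_integrable (CI_Re hc)))) => //.
  apply: intI_le => //; first exact/ctsI_norm/CI_Re.
  by move=> t _; exact: normc_ge_absRe.
apply: (le_trans (le_normr_Rintegral _ (ctsI_integrable (CI_Im hc)))) => //.
apply: intI_le => //; first exact/ctsI_norm/CI_Im.
by move=> t _; exact: normc_ge_absIm.
Qed.

Lemma CI_mul h1 h2 : CI h1 -> CI h2 -> CI (fun t => h1 t * h2 t).
Proof. exact: within_mul. Qed.

Lemma CI_scale (c : R[i]) h : CI h -> CI (fun t => c * h t).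
Proof. by move=> hc; exact: (CI_mul (within_cstC (c := c)) hc). Qed.

Lemma CI_add h1 h2 : CI h1 -> CI h2 -> CI (fun t => h1 t + h2 t).
Proof. exact: within_addC. Qed.

Lemma CI_sub h1 h2 : CI h1 -> CI h2 -> CI (fun t => h1 t - h2 t).
Proof.
move=> c1 c2; under eq_fun do rewrite -mulN1r.
exact: (CI_add c1 (CI_scale (c := -1) c2)).
Qed.

Lemma CI_eqI h1 h2 : eqI h1 h2 -> CI h1 -> CI h2.
Proof. by move=> e; apply: subspace_eq_continuous => t /set_mem; exact: e. Qed.

Definition normL1 h := \Int (fun t => Normc.normc (h t)).
Definition sqnorm2 h := \Int (fun t => Normc.normc (h t) ^+ 2).

Lemma sqnorm2_ge0 h : 0 <= sqnorm2 h.
Proof. by apply: intI_ge0 => t _; exact: sqr_ge0. Qed.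

Lemma normL1_ge0 h : 0 <= normL1 h.
Proof. by apply: intI_ge0 => t _; exact: normc_ge0. Qed.

Lemma normL1_sqr_le h : CI h -> normL1 h ^+ 2 <= 2 * sqnorm2 h.
Proof. by move=> hc; apply: intI_sqr_le; exact: CI_normc. Qed.

Lemma normL1_le_sup h (B : R) : CI h ->
  (forall t, II R t -> Normc.normc (h t) <= B) -> normL1 h <= 2 * B.
Proof.
move=> hc hB; rewrite mulrC -intI_cst.
by apply: intI_le => //; [exact: CI_normc|exact: ctsI_cst].
Qed.

Lemma normc_pairing_le b h (B : R) : CI b -> CI h ->
  (forall t, II R t -> Normc.normc (b t) <= B) ->
  Normc.normc (cintI (fun t => b t * h t)) <= 2 * B * normL1 h.
Proof.
move=> bc hc bB; apply: (le_trans (normc_cintI_le (CI_mul bc hc))).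
rewrite -mulrA ler_pM2l// /normL1 -intIZ; last exact: CI_normc.
apply: intI_le.
- by apply: CI_normc; exact: CI_mul.
- by apply: ctsIM; [exact: ctsI_cst|exact: CI_normc].
by move=> t It; rewrite Normc.normcM ler_wpM2r ?normc_ge0 ?bB.
Qed.

(** All operators met below satisfy a bound of this shape, because an integral
    operator with bounded kernel is controlled by the L1 norm.  Integrating the
    square turns it into a bound for the 2-norm without Minkowski's inequality. *)
Lemma sqnorm2_le_of_pointwise u v (D C : R) : CI u -> CI v -> 0 <= D ->
  (forall t, II R t ->
     Normc.normc (u t) <= C * Normc.normc (v t) + D * normL1 v) ->
  sqnorm2 u <= (2 * C ^+ 2 + 8 * D ^+ 2) * sqnorm2 v.
Proof.
move=> uc vc D0 uv.
have : sqnorm2 u <= \Int (fun t => 2 * C ^+ 2 * Normc.normc (v t) ^+ 2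
                                 + 2 * (D * normL1 v) ^+ 2).
  apply: intI_le.
  - exact: ctsI_normc2.
  - by apply: ctsID; [apply: ctsIM; [|exact: ctsI_normc2]|]; exact: ctsI_cst.
  move=> t It; have := uv t It; have := normc_ge0 (u t).
  have := sqr_ge0 (C * Normc.normc (v t) - D * normL1 v).
  by rewrite !expr2; nra.
rewrite intID; last 2 first.
- by apply: ctsIM; [exact: ctsI_cst|exact: ctsI_normc2].
- exact: ctsI_cst.
rewrite intIZ ?intI_cst -/(sqnorm2 v); last exact: ctsI_normc2.
move=> /le_trans; apply; rewrite [leRHS]mulrDl lerD2l.
have := normL1_sqr_le vc; have := sqr_ge0 D; rewrite exprMn; nra.
Qed.

Lemma sqnorm2_eqI (u v : R -> R[i]) : eqI u v -> sqnorm2 u = sqnorm2 v.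
Proof. by move=> e; apply: eq_Rintegral => t /set_mem It; rewrite e. Qed.

Lemma norm2E (h : R -> R[i]) : norm2 h = Num.sqrt (sqnorm2 h). Proof. by []. Qed.

Lemma norm2_ge0 (h : R -> R[i]) : 0 <= norm2 h. Proof. exact: sqrtr_ge0. Qed.

Lemma norm2_eqI (u v : R -> R[i]) : eqI u v -> norm2 u = norm2 v.
Proof. by move=> e; rewrite !norm2E (sqnorm2_eqI e). Qed.

Lemma norm2Z (a : R) (h : R -> R[i]) : CI h ->
  norm2 (fun t => a%:C * h t) = `|a| * norm2 h.
Proof.
move=> hc; rewrite !norm2E -sqrtr_sqr -sqrtrM ?sqr_ge0//; congr Num.sqrt.
rewrite /sqnorm2 -intIZ; last exact: ctsI_normc2.
apply: eq_Rintegral => t _.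
by rewrite Normc.normcM normc_real exprMn real_normK ?num_real.
Qed.

Lemma norm2_le (u v : R -> R[i]) (C : R) : 0 <= C -> sqnorm2 u <= C * sqnorm2 v ->
  norm2 u <= Num.sqrt C * norm2 v.
Proof.
by move=> C0 uv; rewrite !norm2E -sqrtrM// ler_sqrt// mulr_ge0// sqnorm2_ge0.
Qed.

End Integral.

(** * Integral operators and partitions of unity *)

Section Kernel.
Variable R : realType.
Implicit Types (h : R -> R[i]) (k : R -> R -> R[i]).

Definition kop k h : R -> R[i] := fun s => cintI (fun t => k s t * h t).

Definition slice_cts k := forall s, II R s -> CI (k s).

(** Continuity in the first variable, uniformly in both: the property that makes
    the operator smoothing and the kernel approximable by degenerate ones. *)
Definition equicts k := forall e : R, 0 < e -> exists2 d : R, 0 < d &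
  forall s s' t, II R s -> II R s' -> II R t -> `|s - s'| < d ->
    Normc.normc (k s t - k s' t) < e.

Definition kbounded k (M : R) :=
  forall s t, II R s -> II R t -> Normc.normc (k s t) <= M.

Lemma kopD k h1 h2 s : slice_cts k -> II R s -> CI h1 -> CI h2 ->
  kop k (fun t => h1 t + h2 t) s = kop k h1 s + kop k h2 s.
Proof.
move=> kc Is c1 c2; have ks := kc _ Is.
rewrite /kop -(cintID (CI_mul ks c1) (CI_mul ks c2)).
by apply: cintI_eq => t _; exact: mulrDr.
Qed.

Lemma kopZ k (c : R[i]) h s : slice_cts k -> II R s -> CI h ->
  kop k (fun t => c * h t) s = c * kop k h s.
Proof.
move=> kc Is hc; rewrite /kop -(cintIZ c (CI_mul (kc _ Is) hc)).
by apply: cintI_eq => t _; exact: mulrCA.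
Qed.

Lemma kop_eqI k h1 h2 s : eqI h1 h2 -> kop k h1 s = kop k h2 s.
Proof. by move=> e; apply: cintI_eq => t It; rewrite e. Qed.

Lemma kopB k h1 h2 s : slice_cts k -> II R s -> CI h1 -> CI h2 ->
  kop k (fun t => h1 t - h2 t) s = kop k h1 s - kop k h2 s.
Proof.
move=> kc Is c1 c2.
transitivity (kop k (fun t => h1 t + (-1) * h2 t) s).
  by apply: kop_eqI => t _; rewrite mulN1r.
rewrite (kopD kc Is c1 (CI_scale (c := -1) c2)) (kopZ _ kc Is c2).
by rewrite mulN1r.
Qed.

Lemma kop_sum k (I : Type) (r : seq I) (c : I -> R[i]) (F : I -> R -> R[i]) s :
  slice_cts k -> II R s -> (forall i, CI (F i)) ->
  kop k (fun t => \sum_(i <- r) c i * F i t) s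
  = \sum_(i <- r) c i * kop k (F i) s.
Proof.
move=> kc Is Fc; elim: r => [|i r IH].
  rewrite big_nil -[RHS](@cintI0 R).
  by apply: cintI_eq => t _; rewrite big_nil mulr0.
have rc : CI (fun t => \sum_(j <- r) c j * F j t).
  by apply: within_sum => j; exact: (CI_scale (Fc j)).
rewrite big_cons -IH -(kopZ _ kc Is (Fc i)) -(kopD kc Is (CI_scale (Fc i)) rc).
by apply: kop_eqI => t _; rewrite big_cons.
Qed.

Lemma normc_kop_le k M h s : slice_cts k -> kbounded k M -> II R s -> CI h ->
  Normc.normc (kop k h s) <= 2 * M * normL1 h.
Proof.
move=> kc kM Is hc.
by apply: (normc_pairing_le (kc _ Is) hc) => t It; exact: kM.
Qed.

Lemma CI_kop k h : slice_cts k -> equicts k -> CI h -> CI (kop k h).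
Proof.
move=> kc ke hc; apply/CI_epsP => s Is e e0.
have L0 := normL1_ge0 h.
(* + 1 because normL1 h may vanish *)
have e'0 : 0 < e / (2 * normL1 h + 1) by rewrite divr_gt0//; lra.
have [d d0 dP] := ke _ e'0; exists d => // t It st.
have -> : kop k h s - kop k h t = cintI (fun r => (k s r - k t r) * h r).
  have cs := CI_mul (kc _ Is) hc; have ct := CI_mul (kc _ It) hc.
  rewrite /kop -mulN1r -(cintIZ _ ct) -(cintID cs (CI_scale ct)).
  by apply: cintI_eq => r _; rewrite mulrBl mulN1r.
apply: (@le_lt_trans _ _ (2 * (e / (2 * normL1 h + 1)) * normL1 h)).
  apply: (normc_pairing_le (CI_sub (kc _ Is) (kc _ It)) hc) => r Ir.
  by apply: ltW; exact: dP.
set q := e / _ in e'0 *.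
have -> : e = q * (2 * normL1 h + 1) by rewrite /q divfK// gt_eqF//; lra.
by rewrite [X in _ < X]mulrDr mulr1 [X in _ < X + _]mulrA [q * 2]mulrC ltrDl.
Qed.

(** Hat functions centred at the points [-1 + 2 i / N], whose mesh is below [d],
    divided by their sum, which is positive since some centre is within [d] of
    each point of the interval. *)
Lemma partition_of_unity (d : R) : 0 < d -> exists (N : nat)
  (p : 'I_N -> R) (phi : 'I_N -> R -> R),
  [/\ forall i, II R (p i), forall i, CI (fun s => (phi i s)%:C),
      forall i s, II R s -> 0 <= phi i s,
      forall i s, II R s -> d <= `|s - p i| -> phi i s = 0 &
      forall s, II R s -> \sum_i phi i s = 1].
Proof.
move=> d0.
have [N N0 Nd] : exists2 N : nat, (0 < N)%N & 2 / N%:R < d.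
  exists (Num.truncn (2 / d)).+1 => //.
  by rewrite ltr_pdivrMr ?ltr0n// mulrC -ltr_pdivrMr// truncnS_gt.
have N0' : (0 : R) < N%:R by rewrite ltr0n.
pose p (i : 'I_N.+1) : R := -1 + 2 * i%:R / N%:R.
(* twice the positive part of d - |s - p i| *)
pose psi (i : 'I_N.+1) s : R := (d - `|s - p i|) + `|d - `|s - p i| |.
have psi_ge0 i s : 0 <= psi i s.
  by rewrite /psi; have := ler_norm (- (d - `|s - p i|)); rewrite normrN; lra.
have psi_gt0 i s : `|s - p i| < d -> 0 < psi i s.
  by move=> h; rewrite /psi (ger0_norm (x := d - _)); lra.
have psi_eq0 i s : d <= `|s - p i| -> psi i s = 0.
  by move=> h; rewrite /psi (ler0_norm (x := d - _)); lra.
have psic i : continuous (psi i).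
  have distc : continuous (fun s => d - `|s - p i|).
    move=> x; apply: cvgB; first exact: cvg_cst.
    by apply: cvg_norm; apply: cvgB; [exact: cvg_id|exact: cvg_cst].
  by move=> x; apply: cvgD; [|apply: cvg_norm]; exact: distc.
pose Psi s := \sum_i psi i s.
have Psi_gt0 s : II R s -> 0 < Psi s.
  rewrite /II /= in_itv /= => /andP[s1 s2].
  have i0 : 0 <= (s + 1) * N%:R / 2 by rewrite divr_ge0// mulr_ge0//; lra.
  have iN : (Num.truncn ((s + 1) * N%:R / 2) < N.+1)%N.
    rewrite ltnS -(@ler_nat R); apply: (le_trans (y := (s + 1) * N%:R / 2)).
      by rewrite truncn_le.
    by rewrite ler_pdivrMr// mulrC ler_pM2l//; lra.
  (* the nearest centre on the left of s *)
  rewrite /Psi (bigD1 (Ordinal iN))//= ltr_wpDr ?sumr_ge0//.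
  apply: psi_gt0; rewrite /p /=.
  set j := Num.truncn _ in iN *.
  have j1 : j%:R <= (s + 1) * N%:R / 2 by rewrite truncn_le.
  have j2 : (s + 1) * N%:R / 2 < j%:R + 1.
    by rewrite natr1; exact: truncnS_gt.
  apply: le_lt_trans Nd.
  have -> : s - (-1 + 2 * j%:R / N%:R) = 2 / N%:R * ((s + 1) * N%:R / 2 - j%:R).
    by field; rewrite gt_eqF.
  have q0 : 0 <= 2 / N%:R :> R by rewrite divr_ge0// ltW.
  by rewrite normrM (ger0_norm q0) ler_piMr// ger0_norm; lra.
exists N.+1, p, (fun i s => psi i s / Psi s); split.
- move=> i; rewrite /II /= in_itv /=; have := ltn_ord i.
  rewrite ltnS -(@ler_nat R) => iN.
  have : 0 <= 2 * i%:R / N%:R :> R by rewrite divr_ge0// mulr_ge0.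
  have : 2 * i%:R / N%:R <= 2 :> R by rewrite ler_pdivrMr// ler_pM2l.
  rewrite /p; lra.
- move=> i; apply/within_ReImP; split => /=; last first.
    by apply: continuous_subspaceT => x; exact: cvg_cst.
  apply/subspace_continuousP => s Is; apply: cvgM.
    by apply: cvg_within_filter; exact: psic.
  apply: cvgV; first by rewrite gt_eqF ?Psi_gt0.
  apply: cvg_within_filter; rewrite /Psi.
  by apply: cvg_big; [exact: add_continuous|move=> j _; exact: psic].
- by move=> i s Is; rewrite divr_ge0// ltW ?Psi_gt0.
- by move=> i s Is h; rewrite psi_eq0 ?mul0r.
- by move=> s Is; rewrite -mulr_suml divff// gt_eqF ?Psi_gt0.
Qed.

End Kernel.

(** * Continuous kernels on the square *)

Section UniformContinuity.
Variable R : realType.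
Variable G : R * R -> R[i].
Hypothesis Gc : {within II R `*` II R, continuous (G : R * R -> R[i]^o)}.

Let square_ball (x : R * R) (e : R) : (II R `*` II R) x -> 0 < e ->
  exists2 r : R, 0 < r & forall z, (II R `*` II R) z ->
    `|x.1 - z.1| < r -> `|x.2 - z.2| < r -> Normc.normc (G x - G z) < e.
Proof.
move=> Ax e0; have := iffLR (within_normcP _ _) Gc x Ax e e0.
rewrite /within /= => /nbhs_ballP[r /= r0 rP].
by exists r => // z Az z1 z2; apply: rP => //; split.
Qed.

Lemma continuous_slice_cts : slice_cts (fun s t => G (s, t)).
Proof.
move=> s Is; apply/CI_epsP => t It e e0.
have [r r0 rP] := square_ball (conj Is It : (II R `*` II R) (s, t)) e0.
by exists r => // t' It' tt'; apply: rP => //=; rewrite subrr normr0.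
Qed.

(** Compactness of the square: the modulus of continuity, local at each point of
    the square, is made global by near-covering along [d --> 0+]. *)
Lemma continuous_equicts : equicts (fun s t => G (s, t)).
Proof.
move=> e e0; have e20 : 0 < e / 2 by rewrite divr_gt0.
have cII : compact (II R) by exact: segment_compact.
have /compact_near_coveringP := compact_setX cII cII.
move=> /(_ R (0^'+) (fun d p => (II R `*` II R) p -> forall s', II R s' ->
   `|p.1 - s'| < d -> Normc.normc (G p - G (s', p.2)) < e)).
case.
  move=> x Ax; have [r r0 rP] := square_ball Ax e20.
  exists (ball x (r / 2), [set d | d < r / 2]) => /=.
    split; first by apply: nbhsx_ballx; rewrite divr_gt0.
    by apply: nbhs_right_lt; rewrite divr_gt0.
  move=> [p d] /= [[p1 p2] dr] Ap s' Is' ps'.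
  have h1 : `|x.1 - p.1| < r by apply: (lt_trans p1); lra.
  have h2 : `|x.2 - p.2| < r by apply: (lt_trans p2); lra.
  have h3 : `|x.1 - s'| < r.
    rewrite (splitr r) -(subrKA p.1) (le_lt_trans (ler_normD _ _))// ltrD//.
    exact: lt_trans dr.
  have g1 := rP p Ap h1 h2.
  have g2 := rP (s', p.2) (conj Is' (proj2 Ap)) h3 h2.
  rewrite -(subrKA (G x)) (splitr e).
  by apply: (le_lt_trans (normcD _ _)); rewrite ltrD// normc_distC.
move=> d /= d0 dP; exists (d / 2); first by rewrite divr_gt0.
move=> s s' t Is Is' It ss'.
have d20 : 0 < d / 2 by rewrite divr_gt0.
apply: (dP (d / 2) _ d20 (s, t)) => //=.
by rewrite sub0r normrN gtr0_norm//; lra.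
Qed.

Lemma continuous_kbounded : exists2 M : R, 0 <= M &
  kbounded (fun s t => G (s, t)) M.
Proof.
have cII : compact (II R) by exact: segment_compact.
have /compact_near_coveringP := compact_setX cII cII.
move=> /(_ R (+oo) (fun M p => (II R `*` II R) p -> Normc.normc (G p) <= M)).
case.
  move=> x Ax; have [r r0 rP] := square_ball Ax (@ltr01 R).
  exists (ball x r, [set M | Normc.normc (G x) + 1 < M]) => /=.
    by split; [exact: nbhsx_ballx|apply: nbhs_pinfty_gt; exact: num_real].
  move=> [p M] /= [[p1 p2] pM] Ap; have := rP p Ap p1 p2.
  have := normcD (G p - G x) (G x); rewrite subrK normc_distC.
  by lra.
move=> M [Mr MP].
have M0 : M <= Num.max M 0 by rewrite le_max lexx.
have M1 : M < Num.max M 0 + 1 by lra.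
exists (Num.max M 0 + 1); first by rewrite addr_ge0// le_max lexx orbT.
by move=> s t Is It; apply: (MP _ M1 (s, t)).
Qed.

End UniformContinuity.

(** * Neumann series for a small kernel *)

Section Neumann.
Variable R : realType.
Implicit Types (h : R -> R[i]) (k : R -> R -> R[i]).

(** Nested intervals: [x n - 2 C / 2 ^+ n] increases and [x n + 2 C / 2 ^+ n]
    decreases, so the supremum of the former lies between both for every n. *)
Lemma geometric_limit (x : nat -> R) (C : R) :
  (forall n, `|x n.+1 - x n| <= C / 2 ^+ n) ->
  exists l, forall n, `|l - x n| <= 2 * C / 2 ^+ n.
Proof.
move=> xC.
have C0 : 0 <= C by have := le_trans (normr_ge0 _) (xC 0%N); rewrite expr0 divr1.
pose a n := x n - 2 * C / 2 ^+ n; pose b n := x n + 2 * C / 2 ^+ n.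
have step n : 2 * C / 2 ^+ n.+1 = C / 2 ^+ n.
  by rewrite exprS; field; rewrite expf_neq0.
have half n : 2 * C / 2 ^+ n = 2 * (C / 2 ^+ n) by rewrite mulrA.
have an : nondecreasing_seq a.
  apply/nondecreasing_seqP => n; rewrite /a step half.
  by have := xC n; rewrite ler_norml => /andP[]; lra.
have bn : nonincreasing_seq b.
  apply/nonincreasing_seqP => n; rewrite /b step half.
  by have := xC n; rewrite ler_norml => /andP[]; lra.
have ab n m : a n <= b m.
  apply: (@le_trans _ _ (a (maxn n m))); first by apply: an; exact: leq_maxl.
  apply: (@le_trans _ _ (b (maxn n m))); last by apply: bn; exact: leq_maxr.
  by rewrite /a /b lerD2l ge0_cp// ?divr_ge0 ?mulr_ge0 ?exprn_ge0.
have a0 : has_sup (range a).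
  by split; [exists (a 0%N), 0%N|exists (b 0%N) => _ [n _ <-]].
exists (sup (range a)) => n; rewrite ler_norml; apply/andP; split.
  rewrite lerBrDl; apply: ub_le_sup; first by case: a0.
  by exists n.
rewrite lerBlDl; apply: ge_sup; first by case: a0.
by move=> _ [m _ <-]; exact: ab.
Qed.

Lemma geometric_climit (x : nat -> R[i]) (C : R) :
  (forall n, Normc.normc (x n.+1 - x n) <= C / 2 ^+ n) ->
  exists l, forall n, Normc.normc (l - x n) <= 4 * C / 2 ^+ n.
Proof.
move=> xC.
have [n|a aP] := @geometric_limit (fun n => complex.Re (x n)) C.
  by rewrite -raddfB; exact: le_trans (normc_ge_absRe _) (xC n).
have [n|b bP] := @geometric_limit (fun n => complex.Im (x n)) C.
  by rewrite -raddfB; exact: le_trans (normc_ge_absIm _) (xC n).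
exists (a +i* b) => n; apply: (le_trans (normc_le_absReIm _)).
rewrite !raddfB /=; apply: (le_trans (lerD (aP n) (bP n))).
by rewrite -!mulrA -mulrDl; lra.
Qed.

Lemma geometric_small (C e : R) : 0 < e -> exists n, C / 2 ^+ n < e.
Proof.
move=> e0; exists (Num.truncn (C / e)).+1.
rewrite ltr_pdivrMr ?exprn_gt0// mulrC -ltr_pdivrMr//.
apply: (lt_trans (truncnS_gt _)).
by rewrite -natrX ltr_nat ltn_expl.
Qed.

(** A kernel bounded by 1/8 gives an operator that halves uniform bounds: 2 from
    [normc_cintI_le] and 2 for the length of the interval.  The Picard iterates
    therefore converge uniformly at a geometric rate. *)
Lemma neumann_solution k h : slice_cts k -> (forall g, CI g -> CI (kop k g)) ->
  kbounded k (1 / 8) -> CI h ->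
  exists2 v, CI v & eqI v (fun s => h s + kop k v s).
Proof.
move=> kc ki kb hc.
have half g s B : CI g -> II R s ->
    (forall t, II R t -> Normc.normc (g t) <= B) ->
    Normc.normc (kop k g s) <= B / 2.
  move=> gc Is gB; have := normc_kop_le kc kb Is gc.
  by have := normL1_le_sup gc gB; lra.
have [u [u0 uS]] : exists u : nat -> R -> R[i], u 0%N = h /\
    forall n s, u n.+1 s = h s + kop k (u n) s.
  by exists (fix u n :=
    if n is n'.+1 then (fun s => h s + kop k (u n') s) else h).
have uc n : CI (u n).
  elim: n => [|n IH]; first by rewrite u0.
  by apply: CI_eqI (CI_add hc (ki _ IH)) => s _; rewrite uS.
have [C C0 CP] := CI_bounded (CI_sub (uc 1%N) (uc 0%N)).
have uC n s : II R s -> Normc.normc (u n.+1 s - u n s) <= C / 2 ^+ n.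
  elim: n s => [|n IH] s Is; first by rewrite expr0 divr1; exact: CP.
  have -> : u n.+2 s - u n.+1 s = kop k (fun t => u n.+1 t - u n t) s.
    rewrite (kopB kc Is (uc _) (uc _)) (uS n.+1) (uS n).
    by rewrite opprD addrACA subrr add0r.
  rewrite exprSr invfM mulrA.
  exact: (half _ _ _ (CI_sub (uc _) (uc _)) Is).
have /choice[v vP] : forall s, exists l, II R s ->
    forall n, Normc.normc (l - u n s) <= 4 * C / 2 ^+ n.
  move=> s; have [Is|nIs] := pselect (II R s); last by exists 0.
  by have [l lP] := geometric_climit (fun n => uC n s Is); exists l.
have vc : CI v.
  apply/CI_epsP => s Is e e0.
  have e30 : 0 < e / 3 by rewrite divr_gt0.
  have [n ne] := geometric_small (4 * C) e30.
  have [d d0 dP] := iffLR (CI_epsP _) (uc n) s Is _ e30.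
  exists d => // t It st.
  rewrite -(subrKA (u n s)) -[u n s - v t](subrKA (u n t)).
  apply: (le_lt_trans (normcD _ _)).
  have := normcD (u n s - u n t) (u n t - v t); have := dP t It st.
  have := vP s Is n; have := vP t It n; rewrite (normc_distC (v t)).
  by lra.
exists v => // s Is; apply/eqP; rewrite -subr_eq0; apply/eqP.
apply: Normc.eq0_normc; apply/eqP; rewrite eq_le normc_ge0 andbT.
apply/ler_addgt0Pl => e e0; rewrite addr0.
have [n ne] := geometric_small (4 * C) (divr_gt0 e0 (ltr0n R 2)).
have h1 := vP s Is n.+1.
have h2 : Normc.normc (kop k (fun t => u n t - v t) s) <= (4 * C / 2 ^+ n) / 2.
  apply: (half _ _ _ (CI_sub (uc _) vc) Is) => t It.
  by rewrite normc_distC; exact: vP.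
rewrite (kopB kc Is (uc _) vc) in h2.
have -> : v s - (h s + kop k v s) =
    (v s - u n.+1 s) + (kop k (u n) s - kop k v s).
  by rewrite uS !opprD !addrA; ring.
apply: (le_trans (normcD _ _)).
have h3 : 4 * C / 2 ^+ n.+1 = 4 * C / 2 ^+ n / 2 by rewrite exprSr invfM mulrA.
by rewrite h3 in h1; lra.
Qed.

(** Integrating the pointwise inequality [|v| <= |h| + (1/4) * normL1 v], in which
    the last term contributes half of [normL1 v], absorbs [normL1 v]. *)
Lemma neumann_a_priori k h v : slice_cts k -> kbounded k (1 / 8) ->
  CI h -> CI v ->
  eqI v (fun s => h s + kop k v s) ->
  normL1 v <= 2 * normL1 h /\
  forall s, II R s -> Normc.normc (v s) <= Normc.normc (h s) + 1 / 2 * normL1 h.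
Proof.
move=> kc kb hc vc ve.
have pt s : II R s -> Normc.normc (v s) <= Normc.normc (h s) + 1 / 4 * normL1 v.
  move=> Is; rewrite {1}ve//; apply: (le_trans (normcD _ _)); rewrite lerD2l.
  by have := normc_kop_le kc kb Is vc; lra.
have L1v : normL1 v <= 2 * normL1 h.
  have : normL1 v <= normL1 h + 1 / 4 * normL1 v * 2.
    rewrite -[X in _ + X]intI_cst -intID; [|exact: CI_normc|exact: ctsI_cst].
    apply: intI_le => //; first exact: CI_normc.
    by apply: ctsID; [exact: CI_normc|exact: ctsI_cst].
  by lra.
by split=> // s Is; have := pt s Is; lra.
Qed.

End Neumann.

(** * The Fredholm alternative *)

Section Fredholm.
Variable R : realType.
Implicit Types (h : R -> R[i]) (k : R -> R -> R[i]).

(** With a partition of unity subordinate to the modulus of continuity of [k], the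
    kernel [k1 s t = \sum_i phi i s * k (p i) t] is within 1/8 of [k]: where
    [phi i s] does not vanish, [s] is close to [p i].  The operator of the
    remainder [k0] preserves [CI] as a difference of two operators that do. *)
Lemma degenerate_split k : slice_cts k -> equicts k ->
  exists (N : nat) (p : 'I_N -> R) (phi : 'I_N -> R -> R[i])
         (k0 : R -> R -> R[i]),
  [/\ forall i, II R (p i) /\ CI (phi i), slice_cts k0, kbounded k0 (1 / 8),
      forall h, CI h -> CI (kop k0 h) &
      forall h s, CI h -> II R s ->
        kop k h s = kop k0 h s + \sum_i kop k h (p i) * phi i s].
Proof.
move=> kc ke; have e0 : (0 : R) < 1 / 8 by lra.
have [d d0 dP] := ke _ e0.
have [N [p [phi [pI phic phi_ge0 phi_loc phi1]]]] := partition_of_unity d0.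
pose k1 s t := \sum_i (phi i s)%:C * k (p i) t.
have k1c s : CI (k1 s).
  by apply: within_sum => i; exact: (CI_scale (kc _ (pI i))).
pose k0 s t := k s t - k1 s t.
have k0c : slice_cts k0 by move=> s Is; exact: (CI_sub (kc _ Is) (k1c s)).
have k0P h s : CI h -> II R s ->
    kop k h s = kop k0 h s + \sum_i kop k h (p i) * (phi i s)%:C.
  move=> hc Is.
  have -> : \sum_i kop k h (p i) * (phi i s)%:C = kop k1 h s.
    have kph i : CI (fun t => k (p i) t * h t) := CI_mul (kc _ (pI i)) hc.
    transitivity (\sum_i cintI (fun t => (phi i s)%:C * (k (p i) t * h t))).
      by apply: eq_bigr => i _; rewrite (cintIZ _ (kph i)) mulrC.
    rewrite -(cintI_sum _ (fun i => CI_scale (kph i))).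
    apply: cintI_eq => t _; rewrite /k1 mulr_suml.
    by apply: eq_bigr => i _; rewrite mulrA.
  rewrite /kop -(cintID (CI_mul (k0c _ Is) hc) (CI_mul (k1c s) hc)).
  by apply: cintI_eq => t _; rewrite -mulrDl /k0 subrK.
exists N, p, (fun i s => (phi i s)%:C), k0.
split; [by []|exact: k0c| | |exact: k0P].
- move=> s t Is It.
  have -> : k0 s t = \sum_i (phi i s)%:C * (k s t - k (p i) t).
    under eq_bigr do rewrite mulrBr.
    rewrite sumrB -mulr_suml /k0 /k1; congr (_ - _).
    by rewrite -rmorph_sum phi1// !mul1r.
  apply: (le_trans (normc_sum _ _ _)).
  have -> : 1 / 8 = \sum_i phi i s * (1 / 8).
    by rewrite -mulr_suml phi1// !mul1r.
  apply: ler_sum => i _.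
  rewrite Normc.normcM normc_real ger0_norm ?phi_ge0//.
  have [sp|ps] := ltP `|s - p i| d; last by rewrite phi_loc// !mul0r.
  by apply: ler_wpM2l; [exact: phi_ge0|apply: ltW; exact: dP].
- move=> h hc.
  have fc : CI (fun s => \sum_i kop k h (p i) * (phi i s)%:C).
    by apply: within_sum => i; exact: (CI_scale (phic i)).
  apply: CI_eqI (CI_sub (CI_kop kc ke hc) fc) => s Is.
  by rewrite (k0P _ _ hc Is) addrK.
Qed.

(** Writing [A i] for a solution of [A i - K0 (A i) = phi i] and [v] for one of
    [v - K0 v = f], the function [u = v + \sum_j c_j A j] solves [u - K u = f] as
    soon as the coefficients satisfy [c_i = (K u) (p i)], a square linear system
    [c (1 - M) = beta].  A vector in the kernel of [1 - M] would give a solution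
    of the homogeneous equation, hence is zero; so the matrix is invertible.
    The bound on [u] holds because [c] depends linearly on the point values of
    [K v], which the L1 norm of [v] controls. *)
Lemma fredholm_alternative k : slice_cts k -> equicts k ->
  (forall u, CI u -> eqI u (kop k u) -> eqI u (fun=> 0)) ->
  exists2 D : R, 0 <= D & forall f, CI f -> exists u,
    [/\ CI u, eqI (fun s => u s - kop k u s) f &
        forall s, II R s ->
          Normc.normc (u s) <= Normc.normc (f s) + D * normL1 f].
Proof.
move=> kc ke kinj.
have [N [p [phi [k0 [pphi k0c k0b k0i k0P]]]]] := degenerate_split kc ke.
have /choice[A AP] : forall i, exists a, CI a /\
    eqI a (fun s => phi i s + kop k0 a s).
  move=> i; have [_ phic] := pphi i.
  by have [a ac aP] := neumann_solution k0c k0i k0b phic; exists a.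
have Ac i : CI (A i) by have [] := AP i.
have /choice[a aP] : forall i, exists M, 0 <= M /\
    forall s, II R s -> Normc.normc (A i s) <= M.
  by move=> i; have [M M0 MP] := CI_bounded (Ac i); exists M.
have /choice[b bP] : forall i, exists M, 0 <= M /\
    forall t, II R t -> Normc.normc (k (p i) t) <= M.
  move=> i; have [pI _] := pphi i.
  by have [M M0 MP] := CI_bounded (kc _ pI); exists M.
pose M : 'M[R[i]]_N := \matrix_(j, i) kop k (A j) (p i).
have cAc (c : 'rV[R[i]]_N) : CI (fun s => \sum_j c ord0 j * A j s).
  by apply: within_sum => j; exact: (CI_scale (Ac j)).
have k0A (c : 'rV[R[i]]_N) s : II R s ->
    kop k0 (fun s => \sum_j c ord0 j * A j s) s =
    \sum_j c ord0 j * A j s - \sum_j c ord0 j * phi j s.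
  move=> Is; rewrite (kop_sum _ _ k0c Is Ac) -sumrB.
  apply: eq_bigr => j _; have [_ Aj] := AP j.
  by rewrite (Aj _ Is) -mulrBr [phi j s + _]addrC addrK.
have kA (c : 'rV[R[i]]_N) i :
    kop k (fun s => \sum_j c ord0 j * A j s) (p i) = (c *m M) ord0 i.
  have [pI _] := pphi i; rewrite (kop_sum _ _ kc pI Ac) mxE.
  by apply: eq_bigr => j _; rewrite mxE.
(* a kernel vector c gives the homogeneous solution \sum_j c_j A_j, whose
   coefficients (K u) (p i) are again the entries of c *)
have Munit : (1%:M - M) \in unitmx.
  rewrite unitmxE unitfE; apply/negP => /det0P[c c0 cM].
  have {}cM : c *m M = c.
    by apply/esym/eqP; rewrite -subr_eq0 -{1}[c]mulmx1 -mulmxBr cM.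
  have u0 := kinj _ (cAc c).
  case/negP: c0; apply/eqP/rowP => i; rewrite -cM -kA mxE.
  transitivity (kop k (fun=> 0) (p i)); last first.
    by rewrite /kop -[RHS](@cintI0 R); apply: cintI_eq => t _; rewrite mulr0.
  apply: kop_eqI => t It; apply: u0 It => s Is.
  rewrite (k0P _ _ (cAc c) Is) (k0A _ _ Is).
  rewrite -[LHS]addr0 -addrA; congr (_ + _).
  apply/esym/eqP; rewrite addrC subr_eq0; apply/eqP.
  by apply: eq_bigr => j _; rewrite kA cM.
pose W := invmx (1%:M - M).
pose D := \sum_j (\sum_i 4 * b i * Normc.normc (W i j)) * a j.
have D0 : 0 <= D.
  apply: sumr_ge0 => j _; have [aj _] := aP j.
  rewrite mulr_ge0// sumr_ge0// => i _.
  by have [bi _] := bP i; rewrite !mulr_ge0// normc_ge0.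
exists (1 / 2 + D); first by rewrite addr_ge0.
move=> f fc; have [v vc vP] := neumann_solution k0c k0i k0b fc.
have [L1v vb] := neumann_a_priori k0c k0b fc vc vP.
pose beta : 'rV[R[i]]_N := \row_i kop k v (p i).
pose c := beta *m W.
have cE : c - c *m M = beta.
  by rewrite -{1}[c]mulmx1 -mulmxBr /c /W mulmxKV.
pose w s := \sum_j c ord0 j * A j s.
have wc : CI w := cAc c.
have uc : CI (fun s => v s + w s) := CI_add vc wc.
exists (fun s => v s + w s); split=> //.
  move=> s Is; rewrite (k0P _ _ uc Is) (kopD k0c Is vc wc) (k0A _ _ Is) -/(w s).
  have -> : \sum_i kop k (fun s => v s + w s) (p i) * phi i s =
            \sum_i c ord0 i * phi i s.
    apply: eq_bigr => i _; congr (_ * _); have [pI _] := pphi i.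
    rewrite (kopD kc pI vc wc) kA -[in RHS](subrK (c *m M) c) cE !mxE.
    by [].
  by rewrite {1}vP//; ring.
move=> s Is; apply: (le_trans (normcD _ _)).
have cj j : Normc.normc (c ord0 j) <=
    (\sum_i 4 * b i * Normc.normc (W i j)) * normL1 f.
  rewrite mxE mulr_suml; apply: (le_trans (normc_sum _ _ _)).
  apply: ler_sum => i _; rewrite Normc.normcM mxE mulrAC.
  apply: ler_wpM2r; first exact: normc_ge0.
  have [pI _] := pphi i; have [bi biP] := bP i.
  apply: (le_trans (normc_pairing_le (kc _ pI) vc biP)).
  by rewrite -mulrA [leRHS]mulrAC; nra.
have wD : Normc.normc (w s) <= D * normL1 f.
  apply: (le_trans (normc_sum _ _ _)).
  rewrite /D mulr_suml; apply: ler_sum => j _; have [aj ajP] := aP j.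
  rewrite Normc.normcM mulrAC; apply: ler_pM; rewrite ?normc_ge0//.
  exact: ajP.
by have := vb _ Is; lra.
Qed.

End Fredholm.

(** * Operator norms *)

Section OperatorNorm.
Variable R : realType.
Implicit Types (h : R -> R[i]) (A B : (R -> R[i]) -> (R -> R[i])).

Lemma pointwise_bounded_op A (D : R) : 0 <= D ->
  (forall h, CI h -> CI (A h)) ->
  (forall h s, CI h -> II R s ->
     Normc.normc (A h s) <= Normc.normc (h s) + D * normL1 h) ->
  bounded_op A.
Proof.
move=> D0 Ac AD; exists (Num.sqrt (2 * 1 ^+ 2 + 8 * D ^+ 2)) => h hc.
apply: norm2_le; first by rewrite addr_ge0 ?mulr_ge0 ?exprn_ge0.
apply: (sqnorm2_le_of_pointwise (Ac _ hc) hc D0) => s Is.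
by rewrite mul1r; exact: AD.
Qed.

(** Homogeneity for real scalars suffices to rescale [h] to the unit ball.  It is
    stated on norms only, so that it also applies to an inverse operator, whose
    values are determined on the interval alone. *)
Lemma le_opnorm A h : bounded_op A ->
  (forall (a : R) g, CI g ->
     norm2 (A (fun s => a%:C * g s)) = `|a| * norm2 (A g)) ->
  CI h -> norm2 (A h) <= opnorm A * norm2 h.
Proof.
move=> [M AM] AZ hc; have [h0|h0] := eqVneq (norm2 h) 0.
  (* such an h cannot be rescaled, but boundedness gives norm2 (A h) <= 0 *)
  by have := AM _ hc; rewrite h0 !mulr0.
have hgt0 : 0 < norm2 h by rewrite lt_neqAle eq_sym h0 norm2_ge0.
rewrite -ler_pdivrMr// mulrC; apply: ub_le_sup.
  exists `|M| => _ [g [gc g1] <-]; apply: (le_trans (AM _ gc)).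
  apply: (le_trans (ler_norm _)).
  by rewrite normrM (ger0_norm (norm2_ge0 _)) ler_piMr.
exists (fun s => ((norm2 h)^-1)%:C * h s).
  split; first exact: (CI_scale hc).
  by rewrite (norm2Z _ hc) gtr0_norm ?invr_gt0// mulVf.
by rewrite (AZ _ _ hc) gtr0_norm ?invr_gt0.
Qed.

End OperatorNorm.

(** * Continuity of the networks *)

Section Network.
Variable R : realType.

(** Entrywise continuity avoids any topology on matrices and is insensitive to the
    changes of format made by [conform_mx]. *)
Definition entries_cts (p q : nat) (A : R -> 'M[R]_(p, q)) :=
  forall i j, continuous (fun s => A s i j).

Lemma entries_cts_conform (p q p' q' : nat) (A : R -> 'M[R]_(p, q)) :
  entries_cts A ->
  entries_cts (fun s => conform_mx (0 : 'M[R]_(p', q')) (A s)).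
Proof.
move=> Ac i j; have [pp|pp] := eqVneq p p'; last first.
  under eq_fun do rewrite nonconform_mx ?pp//.
  by move=> s; exact: cvg_cst.
have [qq|qq] := eqVneq q q'; last first.
  under eq_fun do rewrite nonconform_mx ?qq ?orbT//.
  by move=> s; exact: cvg_cst.
subst p' q'; under eq_fun do rewrite conform_mx_id.
exact: Ac.
Qed.

Lemma entries_cts_affine (p q r : nat) (W : 'M[R]_(p, q)) (b : 'M[R]_(p, r))
    (A : R -> 'M[R]_(q, r)) :
  entries_cts A -> entries_cts (fun s => W *m A s + b).
Proof.
move=> Ac i j; under eq_fun do rewrite !mxE.
move=> s; apply: cvgD; last exact: cvg_cst.
apply: cvg_big; first exact: add_continuous.
by move=> l _; apply: cvgM; [exact: cvg_cst|exact: Ac].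
Qed.

Lemma entries_cts_hidden (sigma : R -> R) (m : nat -> nat) (theta : params R m)
    (k : nat) (x : R -> 'cV[R]_(m 0%N)) : continuous sigma ->
  entries_cts x -> entries_cts (fun s => hidden sigma theta k (x s)).
Proof.
move=> sc xc; elim: k => [//|k IH] i j /=.
under eq_fun do rewrite mxE.
move=> s; apply: continuous_comp; last exact: sc.
exact: entries_cts_affine.
Qed.

Variables (sigma : R -> R) (n : nat -> nat) (m : nat -> nat -> nat).
Variable thetas : forall l : nat, params R (m l).
Hypothesis sigma_cont : continuous sigma.

Lemma entries_cts_feat l : entries_cts (feat sigma n thetas l).
Proof.
elim: l => [|l IH] /=.
  by move=> i j; under eq_fun do rewrite mxE; move=> s; exact: cvg_id.
by apply: entries_cts_hidden => //; exact: entries_cts_conform.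
Qed.

Lemma CI_grade_net l (theta : params R (m l)) :
  CI (grade_net sigma n thetas theta).
Proof.
have c : entries_cts (fun s => conform_mx (0 : 'cV[R]_2)
    (network sigma theta (n l) (conform_mx 0 (feat sigma n thetas l.-1 s)))).
  apply: entries_cts_conform; apply: entries_cts_affine.
  apply: entries_cts_hidden => //; apply: entries_cts_conform.
  exact: entries_cts_feat.
by apply/within_ReImP; split; apply: continuous_subspaceT => /=; exact: c.
Qed.

Lemma CI_approx_sol l : CI (approx_sol sigma n thetas l).
Proof. by apply: within_sum => j; exact: CI_grade_net. Qed.

End Network.

(** * The oscillatory equation of the second kind *)

Section OscillatoryKernel.
Variables (R : realType) (kappa : R) (K : R * R -> R[i]).
Hypothesis Kc : {within II R `*` II R, continuous (K : R * R -> R[i]^o)}.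

Definition osc_kernel (p : R * R) : R[i] :=
  K p * cis (kappa * `|p.1 - p.2|).

Lemma osc_kernel_continuous :
  {within II R `*` II R, continuous (osc_kernel : R * R -> R[i]^o)}.
Proof.
apply: (within_mul Kc); apply/within_ReImP.
have phase : continuous (fun p : R * R => kappa * `|p.1 - p.2|).
  move=> p; apply: cvgM; first exact: cvg_cst.
  by apply: cvg_norm; apply: cvgB; [exact: cvg_fst|exact: cvg_snd].
split; apply: continuous_subspaceT => p /=; apply: continuous_comp.
- exact: phase.
- exact: continuous_cos.
- exact: phase.
- exact: continuous_sin.
Qed.

End OscillatoryKernel.

Section SecondKind.
Variables (R : realType) (kappa : R) (K : R * R -> R[i]).
Hypothesis Kc : {within II R `*` II R, continuous (K : R * R -> R[i]^o)}.
Local Notation A := (IKop kappa K).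
Local Notation k := (fun s t => osc_kernel kappa K (s, t)).

Let kc : slice_cts k := continuous_slice_cts (osc_kernel_continuous Kc).
Let ke : equicts k := continuous_equicts (osc_kernel_continuous Kc).

Lemma IKopE h s : A h s = h s - kop k h s. Proof. by []. Qed.

Lemma CI_IKop h : CI h -> CI (A h).
Proof. by move=> hc; exact: (CI_sub hc (CI_kop kc ke hc)). Qed.

Lemma IKopB h1 h2 : CI h1 -> CI h2 ->
  eqI (A (fun s => h1 s - h2 s)) (fun s => A h1 s - A h2 s).
Proof. by move=> c1 c2 s Is; rewrite !IKopE (kopB kc Is c1 c2); ring. Qed.

Lemma IKopZ (c : R[i]) h : CI h ->
  eqI (A (fun s => c * h s)) (fun s => c * A h s).
Proof. by move=> hc s Is; rewrite !IKopE (kopZ c kc Is hc) mulrBr. Qed.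

Lemma bounded_IKop : bounded_op A.
Proof.
have [M M0 kM] :=
  continuous_kbounded (osc_kernel_continuous (kappa := kappa) Kc).
have M20 : 0 <= 2 * M by rewrite mulr_ge0.
apply: (pointwise_bounded_op M20 CI_IKop) => h s hc Is.
rewrite IKopE; apply: (le_trans (normcD _ _)).
by rewrite normc_opp lerD2l (normc_kop_le kc kM Is hc).
Qed.

Lemma norm2_IKopZ (a : R) h : CI h ->
  norm2 (A (fun s => a%:C * h s)) = `|a| * norm2 (A h).
Proof.
by move=> hc; rewrite (norm2_eqI (IKopZ _ hc)) (norm2Z _ (CI_IKop hc)).
Qed.

Hypothesis ev1 : ~ is_eigenvalue (Kop kappa K) 1.

(** A nonzero difference with the same image would be an eigenfunction of the
    integral operator for the eigenvalue 1. *)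
Lemma IKop_inj h1 h2 : CI h1 -> CI h2 -> eqI (A h1) (A h2) -> eqI h1 h2.
Proof.
move=> c1 c2 e; apply: contrapT => ne; apply: ev1.
exists (fun s => h1 s - h2 s); split; first exact: (CI_sub c1 c2).
- move=> e0; apply: ne => s Is.
  by apply/eqP; rewrite -subr_eq0; apply/eqP; exact: e0.
- move=> s Is; rewrite mul1r; apply/esym/eqP; rewrite -subr_eq0; apply/eqP.
  by have := IKopB c1 c2 Is; rewrite e// subrr.
Qed.

Lemma IKop_inverse : exists B, is_inverse_op A B /\ bounded_op B.
Proof.
have kinj u : CI u -> eqI u (kop k u) -> eqI u (fun=> 0).
  move=> uc ue; apply: contrapT => u0; apply: ev1; exists u; split=> //.
  by move=> s Is; rewrite mul1r; apply/esym; exact: ue.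
have [D D0 DP] := fredholm_alternative kc ke kinj.
have /choice[B BP] : forall f, exists u, CI f ->
    [/\ CI u, eqI (A u) f & forall s, II R s ->
      Normc.normc (u s) <= Normc.normc (f s) + D * normL1 f].
  move=> f; have [fc|nfc] := pselect (CI f); last by exists f.
  by have [u uP] := DP _ fc; exists u.
have Bc h : CI h -> CI (B h) by move=> hc; have [] := BP _ hc.
have AB h : CI h -> eqI (A (B h)) h by move=> hc; have [] := BP _ hc.
exists B; split.
  split; [exact: CI_IKop|exact: Bc|exact: AB|move=> h hc].
  have Ahc := CI_IKop hc.
  exact: (IKop_inj (Bc _ Ahc) hc (AB _ Ahc)).
apply: (pointwise_bounded_op D0 Bc) => h s hc.
by have [_ _] := BP _ hc; apply.
Qed.

(** The inverse is homogeneous up to [eqI], since [B (a h)] and [a (B h)] have the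
    same image under an injective operator. *)
Lemma norm2_inverseZ B (a : R) h : is_inverse_op A B -> CI h ->
  norm2 (B (fun s => a%:C * h s)) = `|a| * norm2 (B h).
Proof.
move=> [_ Bc AB _] hc; rewrite -(norm2Z _ (Bc _ hc)).
have ahc : CI (fun s => a%:C * h s) := CI_scale hc.
apply: norm2_eqI; apply: (IKop_inj (Bc _ ahc) (CI_scale (Bc _ hc))) => s Is.
by rewrite (AB _ ahc _ Is) (IKopZ _ (Bc _ hc) Is) (AB _ hc _ Is).
Qed.

(** Both inequalities are the definition of an operator norm, applied to
    [e = A d] for the lower bound and to [d = B e] for the upper one. *)
Lemma residual_bounds B d e : is_inverse_op A B -> bounded_op B -> CI d ->
  eqI e (A d) ->
  (opnorm A)^-1 * norm2 e <= norm2 d <= opnorm B * norm2 e.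
Proof.
move=> iB bB dc eA; have Adc := CI_IKop dc.
have ec : CI e by apply: CI_eqI Adc => s Is; rewrite eA.
rewrite {1}(norm2_eqI eA); apply/andP; split.
  have dA := le_opnorm bounded_IKop norm2_IKopZ dc.
  (* a nonpositive operator norm has a nonpositive inverse, here possibly 0 *)
  have [A0|A0] := ltP 0 (opnorm A); first by rewrite ler_pdivrMl.
  apply: (le_trans _ (norm2_ge0 d)).
  by rewrite mulr_le0_ge0 ?norm2_ge0// invr_le0.
have [_ Bc AB _] := iB.
have -> : norm2 d = norm2 (B e).
  apply: norm2_eqI; apply: (IKop_inj dc (Bc _ ec)) => s Is.
  by rewrite (AB _ ec _ Is) eA.
by apply: le_opnorm => // a g gc; exact: norm2_inverseZ.
Qed.

End SecondKind.

(** The error of grade [l] is the residual of the accumulated solution [y_l],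
    and [f] is the image of [y]; linearity does the rest. *)
Lemma opt_err_residual (R : realType) (kappa : R) (K : R * R -> R[i])
  (f y : R -> R[i]) (sigma : R -> R) (n : nat -> nat) (m : nat -> nat -> nat)
  (thetas : forall l : nat, params R (m l)) (l : nat) :
  {within II R `*` II R, continuous (K : R * R -> R[i]^o)} ->
  CI y -> eqI (IKop kappa K y) f -> continuous sigma -> (0 < l)%N ->
  eqI (opt_err kappa K f sigma n thetas l)
      (IKop kappa K (fun s => y s - approx_sol sigma n thetas l s)).
Proof.
move=> Kc yc yf sc l0 s Is.
have yl := CI_approx_sol sc (n := n) (thetas := thetas) (l := l).
rewrite (IKopB kappa Kc yc yl Is) yf// /opt_err /grade_err.
congr (_ - IKop _ _ _ _); apply/funext => t {yl}.
by case: l l0 Is => // l _ _; rewrite /approx_sol [RHS]big_nat_recr.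
Qed.

Theorem theorem2 (R : realType) (kappa : R) (K : R * R -> R[i]) (f y : R -> R[i])
  (sigma : R -> R) (L : nat) (n : nat -> nat) (m : nat -> nat -> nat)
  (thetas : forall l : nat, params R (m l))
  (kappa_ge1 : 1 <= kappa)
  (K_cont : {within II R `*` II R, continuous (K : R * R -> R[i]^o)})
  (f_cont : CI f)
  (y_cont : CI y)
  (y_sol : eqI (IKop kappa K y) f)
  (sigma_cont : continuous sigma)
  (L_gt0 : (0 < L)%N)
  (n_gt0 : forall l, (1 <= l <= L)%N -> (0 < n l)%N)
  (m_gt0 : forall l j, (1 <= l <= L)%N -> (j <= n l)%N -> (0 < m l j)%N)
  (m_first : m 1%N 0%N = 1%N)
  (m_out : forall l, (1 <= l <= L)%N -> m l (n l) = 2%N)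
  (m_link : forall l, (1 <= l < L)%N -> m l.+1 0%N = m l (n l).-1)
  (thetas_min : forall l, (1 <= l <= L)%N ->
     grade_minimizer kappa K f sigma n thetas l)
  (one_not_eigenvalue : ~ is_eigenvalue (Kop kappa K) 1) :
  bounded_op (IKop kappa K) /\
  exists IKinv : (R -> R[i]) -> (R -> R[i]),
    [/\ is_inverse_op (IKop kappa K) IKinv,
        bounded_op IKinv &
        forall l, (1 <= l <= L)%N ->
          (opnorm (IKop kappa K))^-1 * norm2 (opt_err kappa K f sigma n thetas l)
            <= norm2 (fun s => y s - approx_sol sigma n thetas l s)
            <= opnorm IKinv * norm2 (opt_err kappa K f sigma n thetas l)].
Proof.
split; first exact: bounded_IKop.
have [B [iB bB]] := IKop_inverse K_cont one_not_eigenvalue.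
exists B; split=> // l /andP[l0 _].
have dc : CI (fun s => y s - approx_sol sigma n thetas l s).
  have yl := CI_approx_sol sigma_cont (n := n) (thetas := thetas) (l := l).
  exact: (CI_sub y_cont yl).
apply: (residual_bounds K_cont one_not_eigenvalue iB bB dc).
exact: opt_err_residual.
Qed.
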